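(* Let $w=(w(n))_{n\ge 0}$ be a nondecreasing sequence of positive real numbers such that $$\liminf_{n\to\infty}\frac{w(n)}{n}>0 .$$ (1) If $w(n)=o(n\log n)$ as $n\to\infty$, then $\beta_c(w)=-\infty$. (2) If $w(n)=o(n\sqrt{\log n})$ as $n\to\infty$, then $\beta_c(w)=\widetilde\beta_c(w)=-\infty$.
   Context: Extend $w$ to $[0,\infty)$ by $w(t):=w(\lfloor t\rfloor)$ and set $W(t):=\int_0^t\frac{du}{w(u)}$. When $\sum_{n\ge0} 1/w(n)=\infty$ (which holds automatically in each of the two cases considered), $W$ is a bijection of $[0,\infty)$ onto itself; let $W^{-1}$ be its inverse, with the convention $W^{-1}(u)=0$ for $u<0$. For $\beta\in\mathbb{R}$ define $$J_\beta(w):=\int_0^\infty\frac{dx}{w\big(W^{-1}(2W(x)+\beta)\big)},\qquad \beta_c(w):=\inf\{\beta\in\mathbb{R}: J_\beta(w)<\infty\}\in[-\infty,+\infty].$$ Let $H(x):=x+W^{-1}(W(x)+1)$ for $x\ge0$; $H$ is increasing and continuous, and $H^{-1}$ denotes its inverse, defined on $[H(0),\infty)$, with the convention $H^{-1}(y)=0$ for $0\le y<H(0)$. For $\beta\in\mathbb{R}$ define $$\widetilde J_\beta(w):=\int_0^\infty\frac{dx}{w\big(H^{-1}(W^{-1}(2W(x)+\beta))\big)},\qquad \widetilde\beta_c(w):=\inf\{\beta\in\mathbb{R}:\widetilde J_\beta(w)<\infty\}\in[-\infty,+\infty].$$ In both cases $\inf\emptyset=+\infty$. *)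

(* Defs.v *)
From HB Require Import structures.
From mathcomp Require Import all_boot all_order all_algebra.
From mathcomp Require Import all_classical all_reals all_analysis.
Set Implicit Arguments.
Unset Strict Implicit.
Unset Printing Implicit Defensive.
Import Order.TTheory GRing.Theory Num.Theory.
Import numFieldNormedType.Exports.

Local Open Scope classical_set_scope.
Local Open Scope ring_scope.

Section critical_parameters.
Context {R : realType}.
Variable w : nat -> R.
Local Notation mu := (@lebesgue_measure R).

(* Meant for t >= 0, where Num.truncn is the integer part (it is 0 for t < 0). *)
Definition wext (t : R) : R := w (Num.truncn t).

Definition W (t : R) : R := \int[mu]_(u in `[0, t]) (wext u)^-1.

(* 'pinv_dflt A f is the inverse of f restricted to A, and dflt outside f @` A;
   when the series of the 1 / w n diverges, W @` [0, +oo[ = [0, +oo[ and the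
   default value is only reached at negative arguments. *)
Definition Winv (u : R) : R :=
  if u < 0 then 0 else 'pinv_(fun=> 0) `[0, +oo[ W u.

Definition J (beta : R) : \bar R :=
  (\int[mu]_(x in `[0%R, +oo[) ((wext (Winv (2 * W x + beta)))^-1)%:E)%E.

(* ereal_inf set0 = +oo *)
Definition beta_c : \bar R :=
  ereal_inf [set beta%:E | beta in [set beta : R | (J beta < +oo)%E]].

Definition H (x : R) : R := x + Winv (W x + 1).

Definition Hinv (y : R) : R :=
  if y < H 0 then 0 else 'pinv_(fun=> 0) `[0, +oo[ H y.

Definition Jtilde (beta : R) : \bar R :=
  (\int[mu]_(x in `[0%R, +oo[) ((wext (Hinv (Winv (2 * W x + beta))))^-1)%:E)%E.

Definition betatilde_c : \bar R :=
  ereal_inf [set beta%:E | beta in [set beta : R | (Jtilde beta < +oo)%E]].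

End critical_parameters.

(* Main.v *)
Require Import Defs.
From HB Require Import structures.
From mathcomp Require Import all_boot all_order all_algebra.
From mathcomp Require Import all_classical all_reals all_analysis.
From mathcomp Require Import measurable_realfun ring lra.
Import Order.TTheory GRing.Theory Num.Theory.
Import numFieldNormedType.Exports.
Local Open Scope classical_set_scope.
Local Open Scope ring_scope.

(** Both critical parameters are minus infinity because [J w beta] and
    [Jtilde w beta] are finite for every real [beta].

    The lower limit provides [c > 0] with [w n >= c (n + 3)], whence
    [W b - W a <= (ln (b + 2) - ln (a + 2)) / c] (lemma [WB_le_ln]). The upper bound
    [w n = o(n ln n)] provides, for each [e > 0], a constant [C] with
    [W x >= ln (ln (x + 2)) / e - C] (lemma [W_ge_lnln]); it is used with [e = c / 2].

    Let [y = Winv (2 W x + beta)]. Between [x] and [y] the function [W] increases by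
    [W x + beta], so [y + 2 >= (x + 2) exp (c (W x + beta))], and by the second bound
    the exponential is at least a constant times [ln (x + 2) ^ 2]. Since
    [w y >= c (y + 2)], the integrand of [J] is at most a constant times
    [1 / ((x + 2) ln (x + 2) ^ 2)], which is integrable. Lemma
    [integral_doubling_lty] carries out this estimate for any function [g] with
    [W (g x) >= 2 W x + B] for large [x].

    The point [z = Hinv y] satisfies this with a smaller constant [B]. Indeed
    [y = z + p] with [W p = W z + 1]; then [p >= z], so [p >= y / 2], and the
    logarithmic bound on [W] gives [W z >= W y - 1 - ln 2 / c]. Hence [Jtilde] is
    finite too. Part (2) reduces to the growth condition of part (1), as
    [sqrt (ln n) <= ln n] for large [n]. *)

(** * Integration and inverse functions *)

Section integral_monotonicity.
Import HBNNSimple.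

(** The integral of a nonnegative function is a supremum over the simple functions
    below it, so a pointwise comparison suffices whatever inverse functions occur
    inside the integrands. *)
Lemma ge0_le_integral_pointwise d (T : measurableType d) (R : realType)
    (m : {measure set T -> \bar R}) (D : set T) (f g : T -> \bar R) :
  (forall x, D x -> (0 <= f x)%E) -> (forall x, D x -> (f x <= g x)%E) ->
  (\int[m]_(x in D) f x <= \int[m]_(x in D) g x)%E.
Proof.
move=> f0 fg.
have g0 x : D x -> (0 <= g x)%E by move=> Dx; exact: le_trans (f0 _ Dx) (fg _ Dx).
rewrite !ge0_integralE//; apply: ereal_sup_le => _ [h hf <-].
exists h => // x.
apply: le_trans (hf x) _; rewrite !patchE; case: ifPn => // /set_mem; exact: fg.
Qed.

End integral_monotonicity.

Lemma Rintegral_is_derive (R : realType) (F f : R -> R) (a b : R) : a <= b ->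
  (forall x, a <= x <= b -> is_derive x 1 F (f x)) ->
  (forall x, a <= x <= b -> {for x, continuous f}) ->
  (@lebesgue_measure R).-integrable `[a, b] (EFin \o f) /\
  \int[@lebesgue_measure R]_(x in `[a, b]) f x = F b - F a.
Proof.
move=> ab dF cf.
have cF x : a <= x <= b -> {for x, continuous F}.
  move=> /dF dFx; apply: differentiable_continuous.
  by apply/derivable1_diffP; exact: ex_derive.
have cwf : {within `[a, b], continuous f}.
  by apply: continuous_in_subspaceT => x /set_mem/=; rewrite in_itv/= => /cf.
split; first by apply: continuous_compact_integrable => //; exact: segment_compact.
move: ab; rewrite le_eqVlt => /predU1P[ab|ab].
  by rewrite -ab set_itv1 Rintegral_set1 subrr.
rewrite /Rintegral (continuous_FTC2 ab cwf (F := F)) //.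
- split.
  + by move=> x; rewrite in_itv/= => /andP[ax xb]; apply: ex_derive; apply: dF; rewrite !ltW.
  + by apply: cvg_at_right_filter; apply: cF; rewrite lexx ltW.
  + by apply: cvg_at_left_filter; apply: cF; rewrite lexx ltW.
- move=> x; rewrite in_itv/= => /andP[ax xb]; rewrite derive1E.
  by apply: (@derive_val _ _ _ _ _ _ _ (dF _ _)); rewrite !ltW.
Qed.

Lemma pinv_spec {T : Type} {U : choiceType} (dflt : U -> T) (A : set T) (f : T -> U) (u : U) :
  (exists2 x, A x & f x = u) ->
  A ('pinv_dflt A f u) /\ f ('pinv_dflt A f u) = u.
Proof.
move=> [x Ax fxu]; have fAu : (f @` A) u by exists x.
split; last by apply: pinvK; rewrite inE.
by apply: (@surjpinv_image_sub _ _ dflt A (f @` A) f) => //; exists u.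
Qed.

(** * The function W *)

Section time_change.
Context {R : realType} {w : nat -> R}.
Hypothesis w_gt0 : forall n, 0 < w n.
Hypothesis w_nd : forall m n : nat, (m <= n)%N -> w m <= w n.
Local Notation mu := (@lebesgue_measure R).

Lemma wext_gt0 (x : R) : 0 < wext w x. Proof. exact: w_gt0. Qed.

Lemma le_wext (x y : R) : x <= y -> wext w x <= wext w y.
Proof. by move=> xy; apply: w_nd; exact: le_truncn. Qed.

Lemma integrable_wextV (a b : R) :
  mu.-integrable `[a, b] (EFin \o (fun u : R => (wext w u)^-1)).
Proof.
apply: measurable_bounded_integrable => //.
- by rewrite /= lebesgue_measure_itv/=; case: ifP => //; rewrite -EFinB ltry.
- apply: nonincreasing_measurable => // x y xy.
  by rewrite lef_pV2 ?posrE ?wext_gt0// le_wext.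
- exists (w 0%N)^-1; split; first exact: num_real.
  move=> M /ltW wM u _ /=; apply: le_trans wM.
  by rewrite gtr0_norm ?invr_gt0 ?wext_gt0// lef_pV2 ?posrE ?wext_gt0// w_nd.
Qed.

Lemma WB (a b : R) : 0 <= a -> a <= b ->
  W w b - W w a = \int[mu]_(u in `[a, b]) (wext w u)^-1.
Proof.
move=> a0 ab; rewrite /W Rintegral_itvB ?bnd_simp//; last exact: integrable_wextV.
rewrite Rintegral_itv_obnd_cbnd//.
by apply: integrableS (integrable_wextV a b) => //; exact: subset_itv_oc_cc.
Qed.

(** Bounds on the increments of [W] come from explicit primitives [F] of functions
    [f] that dominate, or are dominated by, the density [1 / w]. *)
Lemma WB_le (F f : R -> R) (a b : R) : 0 <= a -> a <= b ->
  (forall x, a <= x <= b -> is_derive x 1 F (f x)) ->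
  (forall x, a <= x <= b -> {for x, continuous f}) ->
  (forall x, a <= x <= b -> (wext w x)^-1 <= f x) ->
  W w b - W w a <= F b - F a.
Proof.
move=> a0 ab dF cf fle; have [fi <-] := Rintegral_is_derive _ _ _ _ _ ab dF cf.
by rewrite WB//; apply: le_Rintegral => //; exact: integrable_wextV.
Qed.

Lemma WB_ge (F f : R -> R) (a b : R) : 0 <= a -> a <= b ->
  (forall x, a <= x <= b -> is_derive x 1 F (f x)) ->
  (forall x, a <= x <= b -> {for x, continuous f}) ->
  (forall x, a <= x <= b -> f x <= (wext w x)^-1) ->
  F b - F a <= W w b - W w a.
Proof.
move=> a0 ab dF cf fle; have [fi <-] := Rintegral_is_derive _ _ _ _ _ ab dF cf.
by rewrite WB//; apply: le_Rintegral => //; exact: integrable_wextV.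
Qed.

Lemma W0 : W w 0 = 0. Proof. by rewrite /W set_itv1 Rintegral_set1. Qed.

Lemma lt_W (a b : R) : 0 <= a -> a < b -> W w a < W w b.
Proof.
move=> a0 ab; rewrite -subr_gt0.
apply: lt_le_trans (WB_ge (fun x => (wext w b)^-1 * x) (fun=> (wext w b)^-1) _ _ a0 (ltW ab) _ _ _).
- by rewrite -mulrBr mulr_gt0 ?invr_gt0 ?wext_gt0// subr_gt0.
- move=> x _.
  rewrite -[X in is_derive _ _ _ X]mulr1.
  exact: (is_deriveZ (wext w b)^-1 (is_derive_id x 1)).
- by move=> x _; exact: cst_continuous.
- by move=> x /andP[_ xb]; rewrite lef_pV2 ?posrE ?wext_gt0// le_wext.
Qed.

Lemma le_W (a b : R) : 0 <= a -> a <= b -> W w a <= W w b.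
Proof. by move=> a0; rewrite le_eqVlt => /predU1P[->//|/lt_W-/(_ a0)/ltW]. Qed.

Lemma W_le (a b : R) : 0 <= b -> W w a <= W w b -> a <= b.
Proof. by move=> b0; rewrite leNgt => Wab; rewrite leNgt; apply: contra Wab => /lt_W->. Qed.

Lemma W_ge0 (x : R) : 0 <= x -> 0 <= W w x.
Proof. by move=> x0; rewrite -W0 le_W. Qed.

Lemma within_continuous_W (b : R) : 0 <= b -> {within `[0, b], continuous (W w)}.
Proof.
by move=> b0; apply: parameterized_integral_continuous => //; exact: integrable_wextV.
Qed.

End time_change.

(** * Logarithmic primitives and the Bertrand integral *)

Section logarithms.
Context {R : realType}.
Implicit Types x : R.

Lemma ln2_gt0 x : 0 <= x -> 0 < ln (x + 2).
Proof. by move=> x0; apply: ln_gt0; lra. Qed.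

Lemma is_derive_ln2 x : 0 <= x -> is_derive x 1 (fun y => ln (y + 2)) (x + 2)^-1.
Proof.
move=> x0; have x2 : 0 < x + 2 by lra.
have dD : is_derive x 1 (fun y => y + 2) (1 + 0).
  exact: (is_deriveD (is_derive_id x 1) (is_derive_cst (2 : R) x 1)).
have := is_derive1_comp (g := fun y => y + 2) (is_derive1_ln x2) dD; rewrite addr0 mulr1; exact.
Qed.

Lemma is_derive_lnln2 x : 0 <= x ->
  is_derive x 1 (fun y => ln (ln (y + 2))) ((x + 2) * ln (x + 2))^-1.
Proof.
move=> x0; rewrite invfM mulrC.
exact: (is_derive1_comp (g := fun y => ln (y + 2)) (is_derive1_ln (ln2_gt0 _ x0)) (is_derive_ln2 _ x0)).
Qed.

Lemma continuous_ln2 x : 0 <= x -> {for x, continuous (fun y : R => ln (y + 2))}.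
Proof.
move=> /is_derive_ln2 ?; apply: differentiable_continuous.
by apply/derivable1_diffP; exact: ex_derive.
Qed.

Lemma continuous_add2 x : {for x, continuous (fun y : R => y + 2)}.
Proof. by apply: cvgD; [exact: cvg_id|exact: cvg_cst]. Qed.

Lemma le_ln2 x y : 0 <= x -> x <= y -> ln (x + 2) <= ln (y + 2).
Proof. by move=> x0 xy; rewrite ler_ln ?posrE ?lerD2r//; lra. Qed.

(** The denominator of the Bertrand integral with exponent 2: its reciprocal is
    minus the derivative of [1 / ln (x + 2)], hence integrable at infinity. The
    shift by 2 keeps the logarithm positive on the whole half-line. *)
Definition bertrand x : R := (x + 2) * ln (x + 2) ^+ 2.

Lemma bertrand_gt0 x : 0 <= x -> 0 < bertrand x.
Proof. by move=> x0; rewrite /bertrand mulr_gt0 ?exprn_gt0 ?ln2_gt0//; lra. Qed.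

Lemma le_bertrand x y : 0 <= x -> x <= y -> bertrand x <= bertrand y.
Proof.
move=> x0 xy; rewrite ler_pM ?exprn_ge0 ?lerD2r//; first lra.
  by rewrite ltW// ln2_gt0.
by rewrite lerXn2r ?nnegrE ?le_ln2// ltW// ln2_gt0// (le_trans x0).
Qed.

Lemma is_derive_VlnV x (k : R) : 0 <= x ->
  is_derive x 1 (fun y => - k * (ln (y + 2))^-1) (k * (bertrand x)^-1).
Proof.
move=> x0; have l0 := ln2_gt0 _ x0.
have := is_deriveZ (- k) (is_deriveV (f := fun y => ln (y + 2)) (lt0r_neq0 l0) (is_derive_ln2 _ x0)).
rewrite /GRing.scale/= (_ : - k * (_ * _) = k * (bertrand x)^-1)//.
rewrite /bertrand; field.
by rewrite (lt0r_neq0 l0) lt0r_neq0//; lra.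
Qed.

Lemma integral_bertrand_lty (k : R) : 0 <= k ->
  (\int[@lebesgue_measure R]_(x in `[0%R, +oo[) (k * (bertrand x)^-1)%:E < +oo)%E.
Proof.
move=> k0.
rewrite (@ge0_continuous_FTC2y R _ (fun y => - k * (ln (y + 2))^-1) _ 0) //.
- by rewrite -EFinB ltry.
- by move=> x x0; rewrite mulr_ge0 ?invr_ge0 ?(ltW (bertrand_gt0 _ x0)).
- apply: continuous_in_subspaceT => x /set_mem/=; rewrite in_itv/= andbT => x0.
  apply: cvgM; first exact: cvg_cst.
  apply: cvgV; first by rewrite lt0r_neq0 ?bertrand_gt0.
  apply: cvgM; first exact: continuous_add2.
  by under eq_fun do rewrite expr2; rewrite expr2; apply: cvgM; exact: continuous_ln2.
- rewrite -[X in _ --> X](mulr0 (- k)); apply: cvgMr.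
  apply/gtr0_cvgV0.
    by near=> x; apply: ln2_gt0; near: x; apply: nbhs_pinfty_ge; rewrite num_real.
  apply/cvgryPge => A; near=> x; rewrite -[A]expRK.
  have eA : expR A <= x by near: x; apply: nbhs_pinfty_ge; rewrite num_real.
  by rewrite ler_ln ?posrE ?expR_gt0//; have := expR_gt0 A; lra.
- by move=> x /ltW x0; apply: ex_derive; exact: is_derive_VlnV.
- apply: cvg_at_right_filter.
  suff : {for (0 : R), continuous (fun y : R => - k * (ln (y + 2))^-1)} by [].
  apply: differentiable_continuous; apply/derivable1_diffP; apply: ex_derive.
  exact: is_derive_VlnV.
- move=> x; rewrite in_itv/= andbT => /ltW x0; rewrite derive1E.
  by apply: derive_val; exact: is_derive_VlnV.
Unshelve. all: by end_near.
Qed.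

End logarithms.

(** * Growth of W *)

Lemma limn_einf_gt0_ge {R : realType} (v : nat -> R) :
  (0 < limn_einf (fun n => (v n)%:E))%E ->
  exists2 c : R, 0 < c & \forall n \near \oo, c <= v n.
Proof.
rewrite /limn_einf /limn_esup /limf_esup -[X in (X < _)%E]oppe0 lteN2.
move=> /ereal_inf_lt[_ [V ooV <-] supV].
have [c c0 supVc] : exists2 c : R, 0 < c &
    (ereal_sup ((\- (fun n => (v n)%:E))%E @` V) <= (- c)%:E)%E.
  move: supV; case: (ereal_sup _) => [s|//|_]; last by exists 1; rewrite ?leNye.
  by rewrite lte_fin => s0; exists (- s); rewrite ?oppr_gt0 ?opprK.
exists c => //; apply: filterS ooV => n Vn.
rewrite -lerN2 -lee_fin; apply: le_trans supVc.
by apply: ereal_sup_ubound; exists n.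
Qed.

Section growth.
Context {R : realType} {w : nat -> R}.
Hypothesis w_gt0 : forall n, 0 < w n.
Hypothesis w_nd : forall m n : nat, (m <= n)%N -> w m <= w n.

(** The positive lower limit controls [w n / n] only for large [n]; the finitely
    many other terms are absorbed because [w 0 > 0]. The offset 3 leaves room
    for the bound [x + 2 <= n + 3] when [n] is the integer part of [x]. *)
Lemma superlinear_affine :
  (0 < limn_einf (fun n : nat => (w n / n%:R)%:E))%E ->
  exists2 c : R, 0 < c & forall n, c * (n%:R + 3) <= w n.
Proof.
move=> /limn_einf_gt0_ge[c c0 [N _ wN]].
have m0 : 0 < N%:R + 4 :> R by rewrite ltr_wpDl.
have w0 := w_gt0 0%N.
exists (Num.min (c / 4) (w 0%N / (N%:R + 4))).
  by rewrite lt_min !divr_gt0.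
move=> n; have n0 : 0 <= n%:R :> R by [].
have [nN|Nn] := leqP n N.
  apply: le_trans (w_nd _ _ (leq0n n)).
  apply: (@le_trans _ _ (w 0%N / (N%:R + 4) * (n%:R + 3))).
    by rewrite ler_wpM2r ?ge_min ?lexx ?orbT//; lra.
  rewrite -mulrA ler_piMr ?(ltW w0)// mulrC ler_pdivrMr// mul1r.
  have : n%:R <= N%:R :> R by rewrite ler_nat.
  lra.
have n1 : 1 <= n%:R :> R by rewrite ler1n (leq_trans _ Nn).
have cn : c * n%:R <= w n.
  by rewrite -ler_pdivlMr; [apply: wN; exact: ltnW|lra].
apply: le_trans cn.
apply: (@le_trans _ _ (c / 4 * (n%:R + 3))).
  by rewrite ler_wpM2r ?ge_min ?lexx//; lra.
nra.
Qed.

Section superlinear.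
Variable c : R.
Hypothesis c_gt0 : 0 < c.
Hypothesis w_ge : forall n, c * (n%:R + 3) <= w n.

Lemma wext_ge (x : R) : 0 <= x -> c * (x + 2) <= wext w x.
Proof.
move=> x0; apply: le_trans (w_ge _); rewrite ler_pM2l//.
have /andP[_] := truncn_itv x0; rewrite -natr1; lra.
Qed.

(** Since [1 / w] is at most [1 / (c (x + 2))], the function [W] grows at most
    logarithmically. Read backwards, an increase of [W] by [d] forces [x + 2] to
    be multiplied by at least [exp (c d)]. *)
Lemma WB_le_ln (a b : R) : 0 <= a -> a <= b ->
  c * (W w b - W w a) <= ln (b + 2) - ln (a + 2).
Proof.
move=> a0 ab; rewrite mulrC -ler_pdivlMr// mulrC mulrBr.
apply: (WB_le w_gt0 w_nd (fun y => c^-1 * ln (y + 2)) (fun y => c^-1 * (y + 2)^-1) _ _ a0 ab).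
- move=> x /andP[ax _]; exact: (is_deriveZ c^-1 (is_derive_ln2 _ (le_trans a0 ax))).
- move=> x /andP[ax _]; apply: cvgM; first exact: cvg_cst.
  by apply: cvgV; [rewrite lt0r_neq0//; lra | exact: continuous_add2].
- move=> x /andP[ax _]; have x0 := le_trans a0 ax.
  by rewrite -invfM lef_pV2 ?posrE ?wext_gt0 ?wext_ge// mulr_gt0//; lra.
Qed.

End superlinear.

(** From some point on [1 / w] dominates [1 / (e x ln x)], the derivative of
    [ln (ln x) / e]; the constant [C] pays for the initial segment. *)
Lemma W_ge_lnln (e : R) : 0 < e ->
  (\forall n \near \oo, w n <= e * (n%:R * ln (n%:R : R))) ->
  exists C : R, forall x, 0 <= x -> e^-1 * ln (ln (x + 2)) - C <= W w x.
Proof.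
move=> e0 [N _ wN]; set N1 : R := N.+1%:R.
exists (e^-1 * ln (ln (N1 + 2))) => x x0.
have [xN|Nx] := leP x N1.
  (* On the initial segment the left-hand side is nonpositive. *)
  apply: (@le_trans _ _ 0); last exact: W_ge0.
  rewrite subr_le0 ler_pM2l ?invr_gt0// ler_ln ?posrE ?ln2_gt0 ?le_ln2//.
rewrite -mulrBr; set F := fun y => e^-1 * ln (ln (y + 2)).
have N0 : 0 <= N1 by [].
apply: (@le_trans _ _ (W w x - W w N1)); last by rewrite gerBl W_ge0.
rewrite mulrBr.
apply: (WB_ge w_gt0 w_nd F (fun y => e^-1 * ((y + 2) * ln (y + 2))^-1) _ _ N0 (ltW Nx)).
- move=> y /andP[Ny _].
  exact: (is_deriveZ e^-1 (is_derive_lnln2 _ (le_trans N0 Ny))).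
- move=> y /andP[Ny _]; have y0 := le_trans N0 Ny; have l0 := ln2_gt0 _ y0.
  apply: cvgM; first exact: cvg_cst.
  apply: cvgV; first by rewrite lt0r_neq0// mulr_gt0//; lra.
  by apply: cvgM; [exact: continuous_add2|exact: continuous_ln2].
- move=> y /andP[Ny _]; have y0 := le_trans N0 Ny; have l0 := ln2_gt0 _ y0.
  rewrite -invfM lef_pV2 ?posrE ?wext_gt0//; last by rewrite !mulr_gt0//; lra.
  have /andP[ny _] := truncn_itv y0.
  have Nn : (N.+1 <= Num.truncn y)%N by rewrite truncn_ge_nat.
  have n1 : 1 <= (Num.truncn y)%:R :> R by rewrite ler1n (leq_trans _ Nn).
  apply: le_trans (wN _ (ltnW Nn)) _; rewrite ler_pM2l//.
  apply: ler_pM => //; first exact: ln_ge0.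
    by lra.
  by rewrite ler_ln ?posrE//; lra.
Qed.

End growth.

(** * Finiteness of the integrals *)

Section finiteness.
Context {R : realType} {w : nat -> R}.
Hypothesis w_gt0 : forall n, 0 < w n.
Hypothesis w_nd : forall m n : nat, (m <= n)%N -> w m <= w n.

Variables c C : R.
Hypothesis c_gt0 : 0 < c.
Hypothesis w_ge : forall n, c * (n%:R + 3) <= w n.
Hypothesis W_ge : forall x, 0 <= x -> (c / 2)^-1 * ln (ln (x + 2)) - C <= W w x.

Lemma W_unbounded (A : R) : exists2 N : R, 0 <= N & forall x, N <= x -> A <= W w x.
Proof.
exists (expR (expR (c / 2 * (A + C)))); first exact: expR_ge0.
move=> x Nx; have N0 := expR_gt0 (expR (c / 2 * (A + C))).
have x0 : 0 <= x by lra.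
apply: le_trans (W_ge _ x0).
rewrite lerBrDr ler_pdivlMl ?divr_gt0//.
have l0 := ln2_gt0 _ x0.
rewrite -ler_expR lnK ?posrE// -ler_expR lnK ?posrE//; lra.
Qed.

Lemma W_surj (u : R) : 0 <= u -> exists2 x, 0 <= x & W w x = u.
Proof.
move=> u0; have [N N0 WN] := W_unbounded u.
have [|x xN Wx] := IVT N0 (within_continuous_W w_gt0 w_nd _ N0) (v := u).
  by rewrite W0 ge_min u0 le_max WN ?orbT.
by exists x => //; move: xN; rewrite in_itv/= => /andP[].
Qed.

Lemma WinvP (u : R) : 0 <= u -> 0 <= Winv w u /\ W w (Winv w u) = u.
Proof.
move=> u0; rewrite /Winv ltNge u0/=.
have [|] := pinv_spec (fun=> 0) `[0, +oo[ (W w) u.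
  by have [x x0 Wx] := W_surj _ u0; exists x; rewrite //= in_itv/= x0.
by rewrite /= in_itv/= andbT.
Qed.

Lemma WinvE (x u : R) : 0 <= x -> W w x = u -> Winv w u = x.
Proof.
move=> x0 Wx; have u0 : 0 <= u by rewrite -Wx W_ge0.
have [V0 WV] := WinvP _ u0.
by apply/eqP; rewrite eq_le; apply/andP; split; apply: (W_le w_gt0 w_nd) => //;
  rewrite WV Wx.
Qed.

(** Writing [y = z + p], the equation [H z = y] says [W p = W z + 1]. The
    intermediate value theorem applied to [W (y - z) - W z] solves it using only the
    continuity of [W], not that of its inverse. *)
Lemma H_surj (y : R) : H w 0 <= y -> exists2 z, 0 <= z & H w z = y.
Proof.
rewrite /H W0// !add0r => Hy.
have [V0 WV] := WinvP _ ler01.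
have y0 := le_trans V0 Hy.
have cW := within_continuous_W w_gt0 w_nd _ y0.
have cG : {within `[0, y], continuous (fun z => W w (y - z) - W w z)}.
  move=> z; apply: cvgB; last exact: cW.
  move: z; apply/subspace_continuousP => z /=; rewrite in_itv/= => /andP[z0 zy].
  have yzI : `[0, y]%classic (y - z) by rewrite /= in_itv/=; apply/andP; split; lra.
  apply: cvg_comp ((subspace_continuousP _ _).1 cW _ yzI) => P nP.
  have cB : (y - t) @[t --> z] --> y - z by apply: cvgB; [exact: cvg_cst|exact: cvg_id].
  suff : \forall t \near z, `[0, y]%classic t -> P (y - t) by [].
  have nPB : \forall t \near z, `[0, y]%classic (y - t) -> P (y - t) := cB _ nP.
  apply: filterS nPB => t yt; rewrite /= in_itv/= => /andP[t0 ty].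
  by apply: yt; rewrite /= in_itv/=; apply/andP; split; lra.
have [|z] := IVT y0 cG (v := 1).
  rewrite subrr subr0 W0// sub0r subr0.
  rewrite ge_min le_max; apply/andP; split; apply/orP.
    by right; rewrite (le_trans _ ler01)// oppr_le0 W_ge0.
  by left; rewrite -WV le_W.
rewrite in_itv/= => /andP[z0 zy] WzE; exists z => //.
rewrite (WinvE (y - z)) ?subr_ge0//; lra.
Qed.

Lemma HinvP (y : R) : H w 0 <= y -> 0 <= Hinv w y /\ H w (Hinv w y) = y.
Proof.
move=> Hy; rewrite /Hinv ltNge Hy/=.
have [|] := pinv_spec (fun=> 0) `[0, +oo[ (H w) y.
  by have [x x0 Hx] := H_surj _ Hy; exists x; rewrite //= in_itv/= x0.
by rewrite /= in_itv/= andbT.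
Qed.

(** The heart of the argument. If [W (g x) >= 2 W x + B] then [W] increases by at
    least [W x + B] between [x] and [g x], so by the logarithmic upper bound
    [g x + 2 >= (x + 2) exp (c (W x + B))]. The iterated logarithmic lower bound on
    [W], whose factor [2 / c] is chosen for this purpose, turns the exponential
    into at least a constant times [ln (x + 2) ^ 2]. Thus [1 / w (g x)] is at most
    a constant times the integrable function [1 / bertrand x]. *)
Lemma integral_doubling_lty (g : R -> R) (B N : R) : 0 <= N ->
  (forall x, N <= x -> 0 <= g x /\ 2 * W w x + B <= W w (g x)) ->
  (\int[@lebesgue_measure R]_(x in `[0%R, +oo[) ((wext w (g x))^-1)%:E < +oo)%E.
Proof.
move=> N0 gN; have [N1 N10 WN1] := W_unbounded (- B).
(* Beyond N2 the increment W x + B is nonnegative and K is the constant of the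
   estimate; the second argument of the minimum covers the segment [0, N2]. *)
pose N2 := Num.max N N1.
have N20 : 0 <= N2 by rewrite le_max N0.
pose K := expR (c * (B - C)).
pose M := Num.min (c * K) (w 0%N / bertrand N2).
have M0 : 0 < M.
  by rewrite lt_min mulr_gt0 ?expR_gt0// divr_gt0// bertrand_gt0.
have Mle x : 0 <= x -> M * bertrand x <= wext w (g x).
  move=> x0; have b0 := bertrand_gt0 _ x0.
  have [xN2|/ltW] := leP x N2.
    apply: (@le_trans _ _ (w 0%N)); last exact: w_nd.
    apply: (@le_trans _ _ (w 0%N / bertrand N2 * bertrand x)).
      by rewrite ler_wpM2r ?ge_min ?lexx ?orbT// ltW.
    rewrite -mulrA ler_piMr ?(ltW (w_gt0 0%N))// mulrC ler_pdivrMr ?bertrand_gt0//.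
    by rewrite mul1r le_bertrand.
  rewrite ge_max => /andP[/gN[g0 gx] /WN1 Wx].
  have xg : x <= g x by apply: (W_le w_gt0 w_nd) => //; lra.
  have l0 := ln2_gt0 _ x0.
  have lg : ln (x + 2) + 2 * ln (ln (x + 2)) + c * (B - C) <= ln (g x + 2).
    have := WB_le_ln w_gt0 w_nd c c_gt0 w_ge _ _ x0 xg.
    have : 2 * ln (ln (x + 2)) - c * C <= c * W w x.
      have := W_ge _ x0; rewrite -(ler_pM2l c_gt0) mulrBr mulrA.
      by rewrite (_ : c * (c / 2)^-1 = 2)//; field; rewrite lt0r_neq0.
    have : c * (2 * W w x + B) <= c * W w (g x) by rewrite ler_pM2l.
    lra.
  have eg : K * bertrand x <= g x + 2.
    move: lg; rewrite -[_ <= ln (g x + 2)]ler_expR [X in _ <= X -> _]lnK ?posrE; last by lra.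
    rewrite !expRD lnK ?posrE; last by lra.
    by rewrite expRM_natl lnK ?posrE// mulrC.
  apply: le_trans (wext_ge c c_gt0 w_ge _ g0).
  apply: (@le_trans _ _ (c * K * bertrand x)); last by rewrite -mulrA ler_pM2l.
  by rewrite ler_wpM2r ?ge_min ?lexx// ltW.
apply: le_lt_trans (integral_bertrand_lty M^-1 _); last by rewrite invr_ge0 ltW.
apply: ge0_le_integral_pointwise => x /=; rewrite in_itv/= andbT => x0.
  by rewrite lee_fin invr_ge0 ltW ?wext_gt0.
by rewrite lee_fin -invfM lef_pV2 ?posrE ?wext_gt0 ?Mle// mulr_gt0 ?bertrand_gt0.
Qed.

Lemma J_lty (beta : R) : (J w beta < +oo)%E.
Proof.
have [N N0 WN] := W_unbounded `|beta|.
apply: (integral_doubling_lty _ beta N) => // x /WN Wx.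
have [|V0 ->//] := WinvP (2 * W w x + beta).
by move: Wx; have := ler_norm (- beta); rewrite normrN; have := normr_ge0 beta; lra.
Qed.

(** Replacing [y = Winv (2 W x + beta)] by [z = Hinv y] lowers [W] only by a bounded
    amount: [y = z + p] with [W p = W z + 1], so [z <= p] and [y <= 2 p], and halving
    the argument costs [W] at most [ln 2 / c]. *)
Lemma Jtilde_lty (beta : R) : (Jtilde w beta < +oo)%E.
Proof.
have [N N0 WN] := W_unbounded (`|beta| + W w (H w 0)).
have H00 : 0 <= H w 0.
  by rewrite /H W0// !add0r; have [] := WinvP _ ler01.
apply: (integral_doubling_lty _ (beta - 1 - c^-1 * ln 2) N) => // x /WN Wx.
have Wb : W w (H w 0) <= 2 * W w x + beta.
  move: Wx; have := ler_norm (- beta); rewrite normrN; have := normr_ge0 beta.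
  by have := W_ge0 w_gt0 w_nd _ H00; lra.
have [|y0 Wy] := WinvP (2 * W w x + beta).
  exact: le_trans (W_ge0 w_gt0 w_nd _ H00) Wb.
set y := Winv w _ in y0 Wy *.
have Hy : H w 0 <= y by apply: (W_le w_gt0 w_nd) => //; rewrite Wy.
have [z0] := HinvP _ Hy; set z := Hinv w y in z0 *.
rewrite {1}/H; have [|p0 Wp] := WinvP (W w z + 1).
  by rewrite addr_ge0// W_ge0.
set p := Winv w _ in p0 Wp * => zpy; split => //.
have zp : z <= p by apply: (W_le w_gt0 w_nd) => //; rewrite Wp; lra.
have py : p <= y by lra.
have := WB_le_ln w_gt0 w_nd c c_gt0 w_ge _ _ p0 py.
have : ln (y + 2) <= ln 2 + ln (p + 2).
  by rewrite -lnM ?posrE ?ler_ln ?posrE ?mulr_gt0//; lra.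
rewrite Wy Wp => l1 l2.
have : 2 * W w x + beta - (W w z + 1) <= c^-1 * ln 2.
  by rewrite ler_pdivlMl//; lra.
lra.
Qed.

End finiteness.

(** * The critical parameters *)

Lemma ereal_inf_lty_eqNy {R : realType} (F : R -> \bar R) : (forall b, (F b < +oo)%E) ->
  ereal_inf [set beta%:E | beta in [set beta : R | (F beta < +oo)%E]] = -oo%E.
Proof.
by move=> Fy; apply: eq_ninfty => r; apply: ereal_inf_lbound; exists r => //=.
Qed.

Lemma littleo_le {R : realType} (f g : nat -> R) (e : R) : 0 < e ->
  f =o_\oo g -> \forall n \near \oo, f n <= e * `|g n|.
Proof.
move=> e0 /eqoP /(_ e e0); apply: filterS => n; apply: le_trans; exact: ler_norm.
Qed.

Lemma critical_parameters_eqNy (R : realType) (w : nat -> R)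
    (w_gt0 : forall n, 0 < w n)
    (w_nd : forall m n : nat, (m <= n)%N -> w m <= w n)
    (w_liminf : (0 < limn_einf (fun n : nat => (w n / n%:R)%:E))%E) :
  (forall e, 0 < e -> \forall n \near \oo, w n <= e * (n%:R * ln (n%:R : R))) ->
  beta_c w = -oo%E /\ betatilde_c w = -oo%E.
Proof.
move=> wo; have [c c0 wc] := superlinear_affine w_gt0 w_nd w_liminf.
have c20 : 0 < c / 2 by lra.
have [C WC] := W_ge_lnln w_gt0 w_nd _ c20 (wo _ c20).
split; apply: ereal_inf_lty_eqNy => b; [exact: J_lty WC b|exact: Jtilde_lty WC b].
Qed.

Theorem lemma5p1 (R : realType) (w : nat -> R)
    (w_gt0 : forall n, 0 < w n)
    (w_nd : forall m n : nat, (m <= n)%N -> w m <= w n)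
    (w_liminf : (0 < limn_einf (fun n : nat => (w n / n%:R)%:E))%E) :
  (w =o_\oo (fun n : nat => n%:R * ln (n%:R : R)) ->
     beta_c w = -oo%E) /\
  (w =o_\oo (fun n : nat => n%:R * Num.sqrt (ln (n%:R : R))) ->
     beta_c w = -oo%E /\ betatilde_c w = -oo%E).
Proof.
split => wo.
  apply: (critical_parameters_eqNy _ _ w_gt0 w_nd w_liminf _).1 => e e0.
  near=> n; have n1 : (1 <= n)%N by near: n; exact: nbhs_infty_ge.
  rewrite -[X in _ * X]ger0_norm; last by rewrite mulr_ge0 ?ln_ge0 ?ler1n.
  by near: n; exact: littleo_le.
apply: (critical_parameters_eqNy _ _ w_gt0 w_nd w_liminf) => e e0.
near=> n.
have n1 : 1 <= ln n%:R :> R.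
  have en : expR 1 <= n%:R :> R by near: n; exact: nbhs_infty_ger.
  by rewrite -[leLHS]expRK ler_ln ?posrE ?expR_gt0//; exact: lt_le_trans en.
apply: (@le_trans _ _ (e * `|n%:R * Num.sqrt (ln n%:R)|)).
  by near: n; exact: littleo_le.
rewrite ler_pM2l// ger0_norm ?mulr_ge0// ler_wpM2l//.
rewrite -[leRHS](@sqr_sqrtr _ (ln n%:R)) ?(le_trans ler01)// expr2.
by rewrite ler_peMr ?sqrtr_ge0// -[leLHS]sqrtr1 ler_wsqrtr.
Unshelve. all: by end_near.
Qed.
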